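(* Let $(H,\mathcal B,\mu_1)$ be an abelian rational normalizable hypergroup with $h$-integral dual. Let $x_i\in\mathcal B$. If $h_i|d_i|^2>1$ and $h_i|\mu_j(x_i)|^2\in\mathbb A$ for all $j\in\mathcal I$, where $\mathbb A$ is the ring of algebraic integers, then $x_i$ is a vanishing element, i.e. there is $\mu_j\in\widehat{\mathcal B}$ such that $\mu_j(x_i)=0$.
   Context: Abelian rational hypergroup $(H,\mathcal B)$: a finite-dimensional commutative unital associative $\mathbb C$-algebra $H$ with a $\mathbb C$-basis $\mathcal B=\{x_1=1,\dots,x_m\}$, $x_ix_j=\sum_kN_{i,j}^kx_k$ with $N_{i,j}^k\in\mathbb Q$, and an involution $i\mapsto i^*$ of $\mathcal I=\{1,\dots,m\}$ such that $N_{i,i^*}^1>0$ and $N_{i,j}^1=0$ if $j\ne i^*$. Standing assumption: $x_i\mapsto x_{i^*}$ extends to an anti-involution of $H$, i.e. $N_{i,j}^k=N_{j^*,i^*}^{k^*}$; then $H$ is a $*$-algebra (hence semisimple) and $\mu(x_{i^*})=\overline{\mu(x_i)}$ for every algebra morphism $\mu:H\to\mathbb C$. Put $h_i:=1/N_{i,i^*}^1$. $\widehat{\mathcal B}=\{\mu_1,\dots,\mu_m\}$ is the set of all unital algebra morphisms $H\to\mathbb C$, a basis of $H^*$. Normalizable, written $(H,\mathcal B,\mu_1)$, means that $\mu_1\in\widehat{\mathcal B}$ is chosen such that $d_i:=\mu_1(x_i)\ne0$ for all $i$. Dual hypergroup: $H^*$ with basis $\widehat{\mathcal B}$, product $(f\star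 g)(x_i/d_i)=f(x_i/d_i)g(x_i/d_i)$ for all $i$, unit $\mu_1$, involution $\mu_{j^\#}(x_i/d_i)=\mu_j(x_{i^*}/\overline{d_i})$. Write $\mu_i\star\mu_j=\sum_k\widehat p_k(i,j)\mu_k$ and $\widehat h_j:=1/\widehat p_1(j,j^\#)$. The dual is $h$-integral if $\widehat h_j\in\mathbb Z$ for all $j$. *)

(* Defs.v *)
From HB Require Import structures.
From mathcomp Require Import all_boot all_order all_algebra all_field.
From mathcomp Require Import reals complex.
Set Implicit Arguments.
Unset Strict Implicit.
Unset Printing Implicit Defensive.
Import Order.TTheory GRing.Theory Num.Theory.
Local Open Scope ring_scope.

(* Indices start at 0: [ord0] is the index of the unit x_1 = 1 of the basis,  *)
(* and also that of the chosen morphism mu_1 on the dual side.                *)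

Section Hypergroup.
Variables (C : numClosedFieldType) (H : falgType C) (n : nat).
Implicit Types (x : n.+1.-tuple H) (N : 'I_n.+1 -> 'I_n.+1 -> 'I_n.+1 -> rat).
Implicit Types (star sharp : 'I_n.+1 -> 'I_n.+1).
Implicit Types (mu : 'I_n.+1 -> {lrmorphism H -> C^o}).

(* [N i j k] is the structure constant N_{i,j}^k. *)
Record abelian_rational_hypergroup x N star : Prop :=
  AbelianRationalHypergroup {
    hg_comm : forall a b : H, a * b = b * a;
    hg_basis : basis_of {:H} x;
    hg_unit : tnth x ord0 = 1;
    hg_mul : forall i j,
      tnth x i * tnth x j = \sum_k ratr (N i j k) *: tnth x k;
    hg_starK : involutive star;
    hg_star_gt0 : forall i, 0 < N i (star i) ord0;
    hg_star_eq0 : forall i j, j != star i -> N i j ord0 = 0;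
    hg_anti : forall i j k, N i j k = N (star j) (star i) (star k)
  }.

Definition hconst N star (i : 'I_n.+1) : rat := (N i (star i) ord0)^-1.

(* [mu] lists every unital algebra morphism H -> C exactly once. *)
Record characters mu : Prop := Characters {
  char_inj : forall j k, mu j =1 mu k -> j = k;
  char_all : forall f : {lrmorphism H -> C^o}, exists j, f =1 mu j
}.

Definition chdim x mu (i : 'I_n.+1) : C := mu ord0 (tnth x i).

Definition normalizable x mu : Prop := forall i, chdim x mu i != 0.

Definition normalized x mu (i : 'I_n.+1) : H := (chdim x mu i)^-1 *: tnth x i.

(* The linear form f * g of the dual, given by its values on the basis x;     *)
(* [dual_mulE] is its characterization on the elements x_i / d_i.             *)
Definition dual_mul x mu (f g : 'Hom(H, C^o)) : 'Hom(H, C^o) :=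
  \sum_i (chdim x mu i * (f (normalized x mu i) * g (normalized x mu i)))
         *: linfun (coord x i : H -> C^o).

Lemma dual_mulE x mu (f g : 'Hom(H, C^o)) i :
  basis_of {:H} x -> normalizable x mu ->
  dual_mul x mu f g (normalized x mu i) =
  f (normalized x mu i) * g (normalized x mu i).
Proof.
move=> xb dn0; rewrite /dual_mul sum_lfunE.
have coordE j : linfun (coord x j : H -> C^o) (normalized x mu i) =
    (chdim x mu i)^-1 * (i == j)%:R.
  rewrite lfunE /= {1}/normalized linearZ /= (tnth_nth 0) coord_free //.
  exact: basis_free xb.
rewrite (bigD1 i) //= big1 => [|j ji]; rewrite scale_lfunE coordE.
  by rewrite eqxx mulr1 addr0 /GRing.scale /= mulrAC divff ?mul1r.
by rewrite eq_sym (negPf ji) mulr0 scaler0.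
Qed.

Definition dual_basis mu : n.+1.-tuple 'Hom(H, C^o) :=
  [tuple linfun (mu j) | j < n.+1].

(* [dual_const x mu i j k] is the coefficient of mu_k in the dual product of  *)
(* mu_i and mu_j.                                                             *)
Definition dual_const x mu (i j k : 'I_n.+1) : C :=
  coord (dual_basis mu) k (dual_mul x mu (linfun (mu i)) (linfun (mu j))).

(* The involution j |-> j^# of the dual is determined by this equation, but   *)
(* when the d_i are not real the linear form on the right need not be an      *)
(* algebra morphism: that such a [sharp] exists is part of H^* being a        *)
(* hypergroup.                                                                *)
Definition dual_involution x star mu sharp : Prop :=
  forall j i, mu (sharp j) (normalized x mu i) =
              mu j (((chdim x mu i)^*)^-1 *: tnth x (star i)).

Definition dual_hconst x mu sharp (j : 'I_n.+1) : C :=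
  (dual_const x mu j (sharp j) ord0)^-1.

Definition h_integral_dual x mu sharp : Prop :=
  forall j, exists z : int, dual_hconst x mu sharp j = z%:~R.

End Hypergroup.

Definition algebraic_integer (C : numClosedFieldType) (z : C) : Prop :=
  integralOver (intr : int -> C) z.

(* Main.v *)
(* Let [e_j] be the primitive idempotents of H dual to the characters and let *)
(* [tau] be the coefficient of the unit x_1. Positivity of                    *)
(* [a |-> tau (a a^* )] makes all weights [w_j = tau e_j] positive (they are  *)
(* the inverses of the formal codegrees), and [w_j / w_1] is the dual         *)
(* constant of [mu_j], hence a positive integer. For the rational element     *)
(* [y = h_i x_i x_i^*], whose values are [a_j = h_i |mu_j(x_i)|^2],           *)
(* [tau (y ^+ k) = \sum_j w_j a_j ^+ k] is rational, and                      *)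
(* [tau y = tau 1 = 1]. So the multiset of the [a_j], each taken [w_j / w_1]  *)
(* times, has mean 1 and rational power sums. By Newton's identities its      *)
(* product is rational; being an algebraic integer, it is a positive integer  *)
(* if no [a_j] vanishes. The arithmetic-geometric inequality then forces all  *)
(* [a_j] to be 1, against [a_1 > 1].                                          *)
Require Import Defs.
From HB Require Import structures.
From mathcomp Require Import all_boot all_order all_algebra all_field.
From mathcomp Require Import reals complex ring.
Set Implicit Arguments.
Unset Strict Implicit.
Unset Printing Implicit Defensive.
Import Order.TTheory GRing.Theory Num.Theory.
Local Open Scope ring_scope.

(** * Rational numbers and algebraic integers in [C] *)

Section RationalElements.
Variable C : numClosedFieldType.
Implicit Types (z a : C) (s : seq C).

Definition is_rational z := exists q : rat, z = ratr q.

Lemma is_rational_ratr (q : rat) : is_rational (ratr q).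
Proof. by exists q. Qed.

Lemma is_rationalD z w : is_rational z -> is_rational w -> is_rational (z + w).
Proof. by move=> [q ->] [r ->]; exists (q + r); rewrite rmorphD. Qed.

Lemma is_rationalM z w : is_rational z -> is_rational w -> is_rational (z * w).
Proof. by move=> [q ->] [r ->]; exists (q * r); rewrite rmorphM. Qed.

Lemma is_rational_nat m : is_rational m%:R.
Proof. by exists m%:R; rewrite ratr_nat. Qed.

Lemma is_rationalN z : is_rational z -> is_rational (- z).
Proof. by move=> [q ->]; exists (- q); rewrite rmorphN. Qed.

Lemma is_rationalV z : is_rational z -> is_rational z^-1.
Proof. by move=> [q ->]; exists q^-1; rewrite fmorphV. Qed.

Lemma is_rational_sum (I : Type) (r : seq I) (P : pred I) (F : I -> C) :
  (forall i, is_rational (F i)) -> is_rational (\sum_(i <- r | P i) F i).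
Proof.
move=> FQ; apply: big_ind => [||i _]; last exact: FQ.
  exact: (is_rational_nat 0).
exact: is_rationalD.
Qed.

(** The classical fact is available in [algC], while [C] is arbitrary. An integer polynomial
    vanishing at [ratr q] already vanishes at [q] over the rationals, so the root can be moved to
    [algC]. *)
Lemma rational_algebraic_integer z :
  is_rational z -> algebraic_integer z -> exists m : int, z = m%:~R.
Proof.
case=> q -> [p p_mon]; set f := map_poly _ p => rp.
have rq : root (map_poly intr p) q.
  rewrite -(fmorph_root (ratr : rat -> C)) -map_poly_comp.
  rewrite (eq_map_poly (_ : _ =1 (intr : int -> C))) // => m /=.
  by rewrite ratr_int.
have qA : (ratr q : algC) \in Aint.
  apply: (@root_monic_Aint (map_poly intr p)); last 2 first.
  - exact: monic_map.
  - by apply/polyOverP => i; rewrite coef_map /= intr_int.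
  rewrite (eq_map_poly (_ : _ =1 (ratr \o intr : int -> algC))) => [|m /=].
    by rewrite map_poly_comp fmorph_root.
  by rewrite ratr_int.
have /intrP[m] := Cint_rat_Aint (Crat_rat q) qA.
by rewrite -(ratr_int algC m) => /fmorph_inj ->; exists m; rewrite ratr_int.
Qed.

(** * Newton's identities through the reciprocal polynomial, whose coefficients are the signed
    elementary symmetric functions *)

Definition recip_poly s : {poly C} := \prod_(a <- s) (1 - a *: 'X).

Lemma recip_poly_cons a s :
  recip_poly (a :: s) = (1 - a *: 'X) * recip_poly s.
Proof. by rewrite /recip_poly big_cons. Qed.

Lemma coef_recip_poly_cons a s k :
  (recip_poly (a :: s))`_k.+1 = (recip_poly s)`_k.+1 - a * (recip_poly s)`_k.
Proof.
by rewrite recip_poly_cons mulrBl mul1r coefB -scalerAl coefZ coefXM.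
Qed.

Lemma size_recip_poly s : (size (recip_poly s) <= (size s).+1)%N.
Proof.
elim: s => [|a s IH]; first by rewrite /recip_poly big_nil size_poly1.
apply/leq_sizeP => -[|k] //= sk.
have Gk := leq_trans IH sk.
by rewrite coef_recip_poly_cons !nth_default ?mulr0 ?subr0 // ltnW.
Qed.

Lemma top_coef_recip_poly s :
  (recip_poly s)`_(size s) = (-1) ^+ size s * \prod_(a <- s) a.
Proof.
elim: s => [|a s IH]; first by rewrite /recip_poly !big_nil coefC mulr1.
rewrite coef_recip_poly_cons nth_default ?size_recip_poly // IH big_cons exprS.
by rewrite sub0r mulN1r !mulNr mulrCA.
Qed.

(* Newton's identities, modulo 'X^m: the logarithmic derivative of the        *)
(* reciprocal polynomial is minus the generating series of the power sums.    *)
Lemma deriv_recip_poly s m : exists r : {poly C},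
  (recip_poly s)^`() +
    recip_poly s * \poly_(k < m) (\sum_(a <- s) a ^+ k.+1) = r * 'X^m.
Proof.
elim: s => [|a s [r IH]].
  exists 0; rewrite /recip_poly big_nil derivC add0r mul0r mul1r.
  by apply/polyP => k; rewrite coef_poly big_nil coef0; case: ifP.
exists ((1 - a *: 'X) * r - a ^+ m.+1 *: recip_poly s).
have -> : \poly_(k < m) (\sum_(b <- a :: s) b ^+ k.+1) =
    \poly_(k < m) (a ^+ k.+1) + \poly_(k < m) (\sum_(b <- s) b ^+ k.+1).
  apply/polyP => k; rewrite coefD !coef_poly big_cons.
  by case: ifP; rewrite ?addr0.
have geo : (1 - a *: 'X) * \poly_(k < m) (a ^+ k.+1) =
    a%:P - a ^+ m.+1 *: 'X^m :> {poly C}.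
  rewrite poly_def; elim: m {IH} => [|m IHm].
    by rewrite big_ord0 mulr0 expr0 expr1 -mul_polyC mulr1 subrr.
  rewrite big_ord_recr /= mulrDr IHm mulrBl mul1r addrA subrK.
  by rewrite -scalerAr -scalerAl scalerA -exprS -exprSr.
rewrite recip_poly_cons derivM derivB derivZ derivX derivC sub0r.
rewrite -!mul_polyC in geo *.
have -> : ((1 - a%:P * 'X) * r - (a ^+ m.+1)%:P * recip_poly s) * 'X^m =
    (1 - a%:P * 'X) * (r * 'X^m) - (a ^+ m.+1)%:P * 'X^m * recip_poly s by ring.
have -> : (a ^+ m.+1)%:P * 'X^m =
    a%:P - (1 - a%:P * 'X) * \poly_(k < m) (a ^+ k.+1) :> {poly C}.
  by rewrite geo; ring.
by rewrite -IH; ring.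
Qed.

(* The product is rational: it is, up to sign, the top coefficient of the     *)
(* reciprocal polynomial, whose coefficients Newton's identities express      *)
(* through the power sums.                                                    *)
Lemma is_rational_prod s :
  (forall k, is_rational (\sum_(a <- s) a ^+ k)) ->
  is_rational (\prod_(a <- s) a).
Proof.
move=> sQ.
have cQ k : is_rational (recip_poly s)`_k.
  elim/ltn_ind: k => -[_|k IH].
    rewrite -horner_coef0 horner_prod big1 => [|a _].
      exact: (is_rational_nat 1).
    by rewrite hornerD hornerN hornerZ hornerX hornerC mulr0 subr0.
  have [r] := deriv_recip_poly s k.+1.
  (* At degree [k] the right side vanishes, being a multiple of ['X^k.+1]. The left side is [k.+1]
     times the next coefficient plus products of earlier coefficients and power sums. *)
  move/(congr1 (fun p : {poly C} => p`_k)).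
  rewrite coefD coef_deriv coefMXn ltnSn coefM => /eqP.
  rewrite addr_eq0 -mulr_natr => /eqP dG.
  have -> : (recip_poly s)`_k.+1 = (recip_poly s)`_k.+1 * k.+1%:R * k.+1%:R^-1.
    by rewrite mulfK // pnatr_eq0.
  rewrite dG; apply: is_rationalM; last exact/is_rationalV/is_rational_nat.
  apply/is_rationalN/is_rational_sum => i; apply: is_rationalM.
    exact/IH/ltn_ord.
  by rewrite coef_poly ltnS leq_subr.
have -> : \prod_(a <- s) a = (-1) ^+ size s * (recip_poly s)`_(size s).
  by rewrite top_coef_recip_poly mulrA -exprMn mulrNN mulr1 expr1n mul1r.
apply: is_rationalM; last exact: cQ.
by exists ((-1) ^+ size s); rewrite rmorphXn rmorphN1.
Qed.

Lemma algebraic_integer_prod s :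
  (forall a, a \in s -> algebraic_integer a) ->
  algebraic_integer (\prod_(a <- s) a).
Proof.
move=> sA; rewrite big_seq; apply: big_ind => [|a b|a /sA //].
  exact: (integral1 (intr : {rmorphism int -> C})).
exact: (@integral_mul _ _ (intr : {rmorphism int -> C})).
Qed.

(* The product of the elements is a positive integer, so equality holds in    *)
(* the arithmetic-geometric inequality.                                       *)
Lemma mean1_integer_eq1 s :
  (forall a, a \in s -> 0 < a) -> (forall a, a \in s -> algebraic_integer a) ->
  (forall k, is_rational (\sum_(a <- s) a ^+ k)) ->
  \sum_(a <- s) a = (size s)%:R ->
  forall a, a \in s -> a = 1.
Proof.
move=> s_gt0 sA sQ s_mean a0 a0s.
have prod_ge1 : 1 <= \prod_(a <- s) a.
  have [m Em] := rational_algebraic_integer (is_rational_prod sQ)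
                   (algebraic_integer_prod sA).
  have : 0 < \prod_(a <- s) a by rewrite big_seq prodr_gt0.
  by rewrite Em ltr0z ler1z gtz0_ge1.
have n_gt0 : (0 < size s)%N by case: (s) a0s.
have n_neq0 : (size s)%:R != 0 :> C by rewrite pnatr_eq0 -lt0n.
(* Scaled so that the [E i] sum to 1; the inequality then bounds the product of [s] by 1. *)
pose E (i : 'I_(size s)) : C := nth 0 s i / (size s)%:R.
have EE i : E i *+ size s = nth 0 s i by rewrite -mulr_natr divfK.
have sumE : \sum_(i in predT) E i = 1.
  have -> : 1 = (\sum_(a <- s) a) / (size s)%:R by rewrite s_mean divff.
  by rewrite (big_nth 0) big_mkord mulr_suml.
have prodE : \prod_(i in predT) (E i *+ size s) = \prod_(a <- s) a.
  by rewrite (big_nth 0) big_mkord; apply: eq_bigr.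
have E_ge0 : {in predT, forall i, 0 <= E i *+ #|'I_(size s)|}.
  by move=> i _; rewrite card_ord EE ltW // s_gt0 // mem_nth.
have [] := leif_AGM_scaled E_ge0.
rewrite card_ord sumE prodE expr1n => prod_le1.
(* The product is squeezed to 1, so the equality case makes all elements equal; their mean then
   gives the common value. *)
rewrite eq_le prod_le1 prod_ge1 => /esym eqE.
have {}eqE a : a \in s -> a = a0.
  move=> /(nthP 0)[i si <-]; have /(nthP 0)[j sj <-] := a0s.
  have /eqP := forall_inP (forall_inP eqE (Ordinal si) isT) (Ordinal sj) isT.
  by rewrite -(EE (Ordinal si)) -(EE (Ordinal sj)) => ->.
move: s_mean; rewrite big_seq (eq_bigr (fun=> a0)) // -big_seq big_const_seq.
rewrite count_predT iter_addr addr0 -[_ *+ _]mulr_natr -[RHS]mul1r.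
by move/(mulIf n_neq0).
Qed.
End RationalElements.

(** * Primitive idempotents of the hypergroup algebra *)

Section Hypergroup.
Variables (C : numClosedFieldType) (H : falgType C) (n : nat).
Variables (x : n.+1.-tuple H) (N : 'I_n.+1 -> 'I_n.+1 -> 'I_n.+1 -> rat).
Variables (star : 'I_n.+1 -> 'I_n.+1) (mu : 'I_n.+1 -> {lrmorphism H -> C^o}).
Hypothesis hg : abelian_rational_hypergroup x N star.

Let xb := hg_basis hg.

Lemma basis_sum a : a = \sum_k coord x k a *: tnth x k.
Proof.
rewrite {1}(coord_basis xb (memvf a)).
by apply: eq_bigr => k _; rewrite (tnth_nth 0).
Qed.

Lemma coord_tnth i k : coord x i (tnth x k) = (k == i)%:R.
Proof. by rewrite (tnth_nth 0) coord_free // (basis_free xb). Qed.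

(** Lagrange interpolation: distinct characters differ on some basis element, an affine function of
    which is 1 at one and 0 at the other; [e k] is a product of such separators. *)
Lemma exists_idempotents : (forall j k, mu j =1 mu k -> j = k) ->
  exists e : 'I_n.+1 -> H, forall j k, mu j (e k) = (j == k)%:R.
Proof.
move=> mu_inj.
have sep j k : exists s : H, k != j -> mu j s = 1 /\ mu k s = 0.
  have [->|kj] := eqVneq k j; first by exists 0.
  have /existsP[i di] : [exists i, mu j (tnth x i) != mu k (tnth x i)].
    apply: contraR kj; rewrite negb_exists => /forallP eq_jk.
    apply/eqP/esym/mu_inj => a; rewrite (basis_sum a) !linear_sum.
    by apply: eq_bigr => i _; rewrite !linearZ /= (eqP (negbNE (eq_jk i))).
  exists ((mu j (tnth x i) - mu k (tnth x i))^-1 *: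
          (tnth x i - mu k (tnth x i) *: 1)).
  have mu_sep l : mu l ((mu j (tnth x i) - mu k (tnth x i))^-1 *:
      (tnth x i - mu k (tnth x i) *: 1)) =
      (mu j (tnth x i) - mu k (tnth x i))^-1 *
      (mu l (tnth x i) - mu k (tnth x i)).
    rewrite linearZ /= linearB /= [X in _ *: (_ - X)]linearZ /= rmorph1.
    by rewrite /GRing.scale /= mulr1.
  by rewrite !mu_sep subrr mulr0 mulVf // subr_eq0.
have [s sE] := fin_all_exists (fun j => fin_all_exists (sep j)).
exists (fun k => \prod_(l | l != k) s k l) => j k; rewrite rmorph_prod.
have [->|jk] := eqVneq j k; first by rewrite big1 // => l /sE[].
by rewrite (bigD1 j) //= (sE _ _ jk).2 mul0r.
Qed.

Variable e : 'I_n.+1 -> H.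
Hypothesis mu_e : forall j k, mu j (e k) = (j == k)%:R.

Lemma idempotent_neq0 j : e j != 0.
Proof.
apply: contra_eqN (mu_e j j) => /eqP->.
by rewrite linear0 eqxx eq_sym oner_eq0.
Qed.

(** The [mu j] read off coefficients, so the [e j] are free, and there are as many of them as the
    dimension. *)
Lemma idempotent_sum a : a = \sum_j mu j a *: e j.
Proof.
have mu_sum (c : 'I_n.+1 -> C) j : mu j (\sum_k c k *: e k) = c j.
  rewrite linear_sum (bigD1 j) //= linearZ /= mu_e eqxx big1 => [|k kj].
    by rewrite addr0 /GRing.scale /= mulr1.
  by rewrite linearZ /= mu_e eq_sym (negPf kj) scaler0.
have eb : basis_of {:H} [tuple e j | j < n.+1].
  have dimH : \dim {:H} = n.+1 by rewrite (size_basis xb).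
  rewrite basisEfree subvf size_tuple dimH leqnn !andbT.
  apply/freeP => c c0 j; rewrite -(mu_sum c j).
  transitivity (mu j 0); last exact: linear0.
  rewrite -[in RHS]c0; congr (mu j _).
  by apply: eq_bigr => k _; rewrite -tnth_nth tnth_mktuple.
have {}aE : a = \sum_j coord [tuple e j | j < n.+1] j a *: e j.
  rewrite {1}(coord_basis eb (memvf a)).
  by apply: eq_bigr => k _; rewrite -tnth_nth tnth_mktuple.
by rewrite {1}aE; apply: eq_bigr => j _; rewrite {2}aE mu_sum.
Qed.

Lemma characters_separate a b : (forall j, mu j a = mu j b) -> a = b.
Proof.
move=> ab; rewrite (idempotent_sum a) (idempotent_sum b).
by apply: eq_bigr => j _; rewrite ab.
Qed.

Lemma mul_idempotent a j : a * e j = mu j a *: e j.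
Proof.
apply: characters_separate => k.
rewrite rmorphM linearZ /= mu_e /GRing.scale /=.
by case: eqVneq => [->|_] //; rewrite !mulr0.
Qed.

(** * The adjoint and the positive form it defines *)

Definition adjoint a := \sum_k (coord x k a)^* *: tnth x (star k).

Lemma adjointZ c a : adjoint (c *: a) = c^* *: adjoint a.
Proof.
by rewrite scaler_sumr; apply: eq_bigr => k _; rewrite linearZ rmorphM scalerA.
Qed.

Lemma adjoint_sum (I : finType) (F : I -> H) :
  adjoint (\sum_i F i) = \sum_i adjoint (F i).
Proof.
rewrite /adjoint exchange_big; apply: eq_bigr => k _.
by rewrite linear_sum rmorph_sum scaler_suml.
Qed.

Lemma adjoint_basis k : adjoint (tnth x k) = tnth x (star k).
Proof.
rewrite /adjoint (bigD1 k) //= coord_tnth eqxx rmorph1 scale1r big1 ?addr0 //.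
by move=> l lk; rewrite coord_tnth eq_sym (negPf lk) rmorph0 scale0r.
Qed.

(** Conjugation fixes the rational structure constants, and commutativity undoes the reversal in
    [hg_anti]. *)
Lemma adjointM i a : adjoint (tnth x i * a) = tnth x (star i) * adjoint a.
Proof.
rewrite [a in LHS]basis_sum mulr_sumr adjoint_sum [in RHS]/adjoint mulr_sumr.
apply: eq_bigr => k _; rewrite -!scalerAr adjointZ; congr (_ *: _).
rewrite (hg_mul hg) adjoint_sum (hg_comm hg) (hg_mul hg).
rewrite (reindex_inj (inv_inj (hg_starK hg))) /=; apply: eq_bigr => l _.
rewrite adjointZ adjoint_basis (hg_starK hg) (hg_anti hg) (hg_starK hg).
by rewrite fmorph_rat.
Qed.

Definition unit_coord a : C := coord x ord0 a.

Lemma unit_coord_mul_star a i :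
  unit_coord (a * tnth x (star i)) = coord x i a * ratr (N i (star i) ord0).
Proof.
rewrite /unit_coord [a in LHS]basis_sum mulr_suml linear_sum.
have coordM k j : coord x ord0 (tnth x k * tnth x j) = ratr (N k j ord0).
  rewrite (hg_mul hg) linear_sum (bigD1 ord0) //= linearZ /= coord_tnth eqxx.
  rewrite mulr1 big1 ?addr0 // => l l0.
  by rewrite linearZ /= coord_tnth (negPf l0) mulr0.
rewrite (bigD1 i) //= -scalerAl linearZ /= coordM big1 ?addr0 // => k ki.
rewrite -scalerAl linearZ /= coordM (hg_star_eq0 hg) ?rmorph0 ?mulr0 //.
by rewrite (inj_eq (inv_inj (hg_starK hg))) eq_sym.
Qed.

(** In the basis [x] this form is diagonal with positive entries. *)
Lemma unit_coord_adjoint_gt0 a : a != 0 -> 0 < unit_coord (a * adjoint a).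
Proof.
move=> a0; have N_gt0 i : 0 < ratr (N i (star i) ord0) :> C.
  by rewrite ltr0q (hg_star_gt0 hg).
have -> : unit_coord (a * adjoint a) =
    \sum_i `|coord x i a| ^+ 2 * ratr (N i (star i) ord0).
  rewrite /adjoint mulr_sumr /unit_coord linear_sum; apply: eq_bigr => i _.
  rewrite -scalerAr linearZ /= [X in _ * X]unit_coord_mul_star normCK; ring.
have ge0 i : 0 <= `|coord x i a| ^+ 2 * ratr (N i (star i) ord0).
  by rewrite mulr_ge0 ?exprn_ge0 // ltW.
rewrite lt_neqAle sumr_ge0 // andbT eq_sym; apply: contra a0.
rewrite psumr_eq0 // => /allP s0; rewrite (basis_sum a) big1 // => i _.
have := s0 i (mem_index_enum i).
rewrite mulf_eq0 (gt_eqF (N_gt0 i)) orbF expf_eq0 normr_eq0 => /eqP->.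
by rewrite scale0r.
Qed.

(* Apply [mu j] to the adjoint of [x_i e_j = mu_j(x_i) e_j]; positivity of    *)
(* the unit coordinate of [e_j (adjoint e_j)] prevents [mu_j (adjoint e_j)]   *)
(* from vanishing.                                                            *)
Lemma mu_star j i : mu j (tnth x (star i)) = (mu j (tnth x i))^*.
Proof.
have nz : mu j (adjoint (e j)) != 0.
  apply/eqP => z; have := unit_coord_adjoint_gt0 (idempotent_neq0 j).
  by rewrite (hg_comm hg) mul_idempotent z scale0r /unit_coord linear0 ltxx.
apply: (mulIf nz).
by rewrite -rmorphM -adjointM mul_idempotent adjointZ /= linearZ.
Qed.

Lemma mu_adjoint j a : mu j (adjoint a) = (mu j a)^*.
Proof.
rewrite [a in RHS]basis_sum /adjoint !linear_sum rmorph_sum.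
apply: eq_bigr => k _.
by rewrite !linearZ /= mu_star rmorphM.
Qed.

(** * Weights, formal codegrees and dual constants *)

Definition weight j := unit_coord (e j).

(** Multiplying [e j] by its adjoint gives back [e j]. *)
Lemma weight_gt0 j : 0 < weight j.
Proof.
have -> : weight j = unit_coord (e j * adjoint (e j)).
  rewrite (hg_comm hg) mul_idempotent mu_adjoint mu_e eqxx.
  by rewrite rmorph1 scale1r.
exact/unit_coord_adjoint_gt0/idempotent_neq0.
Qed.

Lemma unit_coordE a : unit_coord a = \sum_j weight j * mu j a.
Proof.
rewrite /unit_coord {1}(idempotent_sum a) linear_sum; apply: eq_bigr => j _.
by rewrite linearZ mulrC.
Qed.

(** Take the unit coordinate of [e j * tnth x (star i)], computed both in the basis and by the
    eigenvalue of [e j]. *)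
Lemma coord_idempotent i j :
  coord x i (e j) = ratr (hconst N star i) * (mu j (tnth x i))^* * weight j.
Proof.
have N_neq0 : ratr (N i (star i) ord0) != 0 :> C.
  by rewrite fmorph_eq0 gt_eqF // (hg_star_gt0 hg).
apply: (mulIf N_neq0); rewrite -unit_coord_mul_star (hg_comm hg) mul_idempotent.
rewrite mu_star /unit_coord linearZ /= fmorphV -/(unit_coord _) -/(weight j).
by field.
Qed.

Lemma formal_codegree j :
  weight j * \sum_i ratr (hconst N star i) * `|mu j (tnth x i)| ^+ 2 = 1.
Proof.
have <- : mu j (e j) = 1 by rewrite mu_e eqxx.
rewrite [e j in RHS]basis_sum linear_sum mulr_sumr; apply: eq_bigr => i _.
by rewrite linearZ /= coord_idempotent normCK /GRing.scale /=; ring.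
Qed.

Lemma coord_dual_basis (f : 'Hom(H, C^o)) k :
  coord (dual_basis mu) k f = f (e k).
Proof.
have nthE (i : 'I_n.+1) : (dual_basis mu)`_i = linfun (mu i).
  by rewrite -tnth_nth tnth_mktuple.
have evalE (c : 'I_n.+1 -> C) j :
    (\sum_i c i *: (dual_basis mu)`_i) (e j) = c j.
  rewrite sum_lfunE (bigD1 j) //= nthE scale_lfunE lfunE /=.
  rewrite mu_e eqxx /GRing.scale /= mulr1 big1 ?addr0 // => i ij.
  by rewrite nthE scale_lfunE lfunE /= mu_e (negPf ij) scaler0.
have free_dual : free (dual_basis mu).
  by apply/freeP => c c0 j; rewrite -(evalE c j) c0 lfunE.
have -> : f = \sum_i f (e i) *: (dual_basis mu)`_i.
  apply/lfunP => a; rewrite {1}(idempotent_sum a) sum_lfunE linear_sum.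
  apply: eq_bigr => i _; rewrite nthE scale_lfunE lfunE /=.
  by rewrite linearZ /= /GRing.scale /= mulrC.
by rewrite (coord_sum_free _ _ free_dual) evalE.
Qed.

(** The dual constant is the dual product evaluated at [e ord0]. There all [d_i] cancel, leaving
    [weight ord0] times the formal codegree of [mu j]. *)
Lemma dual_hconstE sharp j :
  normalizable x mu -> dual_involution x star mu sharp ->
  dual_hconst x mu sharp j = weight j / weight ord0.
Proof.
move=> d_neq0 sharpE; rewrite /dual_hconst -[RHS]invrK invf_div; congr (_^-1).
rewrite /dual_const coord_dual_basis /dual_mul sum_lfunE.
have -> : weight ord0 / weight j = weight ord0 *
    \sum_i ratr (hconst N star i) * `|mu j (tnth x i)| ^+ 2.
  have w_neq0 : weight j != 0 by rewrite gt_eqF // weight_gt0.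
  by congr (_ * _); apply: (mulfI w_neq0); rewrite formal_codegree divff.
rewrite mulr_sumr; apply: eq_bigr => i _; have d0 := d_neq0 i.
rewrite scale_lfunE !lfunE /= sharpE /normalized !linearZ /= mu_star normCK.
rewrite coord_idempotent -/(chdim x mu i) /GRing.scale /=.
have dc0 : (chdim x mu i)^* != 0 by rewrite fmorph_eq0.
by field; rewrite d0 dc0.
Qed.

(** Elements with rational coordinates are closed under products, since the structure constants are
    rational. *)
Lemma unit_coord_rational_power i k :
  is_rational (unit_coord
    ((ratr (hconst N star i) *: (tnth x i * tnth x (star i))) ^+ k)).
Proof.
pose Q a := forall l, is_rational (coord x l a).
suff: Q ((ratr (hconst N star i) *: (tnth x i * tnth x (star i))) ^+ k).
  by apply.
have QZ (q : rat) a : Q a -> Q (ratr q *: a).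
  move=> Qa m; rewrite linearZ /=; apply: is_rationalM => //.
  exact: is_rational_ratr.
have Qsum (F : 'I_n.+1 -> H) : (forall m, Q (F m)) -> Q (\sum_m F m).
  by move=> QF m; rewrite linear_sum; apply: is_rational_sum => p; apply: QF.
have Qx m : Q (tnth x m).
  by move=> p; rewrite coord_tnth; exact: is_rational_nat.
have QM a b : Q a -> Q b -> Q (a * b).
  move=> Qa Qb; rewrite (basis_sum a) mulr_suml; apply: (Qsum) => m.
  have [q ->] := Qa m; rewrite -scalerAl; apply: (QZ).
  rewrite (basis_sum b) mulr_sumr; apply: (Qsum) => p.
  have [r ->] := Qb p; rewrite -scalerAr; apply: (QZ).
  by rewrite (hg_mul hg); apply: (Qsum) => s; exact: QZ.
elim: k => [|k IH]; last first.
  rewrite exprS; exact: (QM _ _ (QZ _ _ (QM _ _ (Qx _) (Qx _))) IH).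
by rewrite expr0 -(hg_unit hg); exact: Qx.
Qed.

End Hypergroup.

(** * The multiset of values and the contradiction *)

Lemma vanishing_element (C : numClosedFieldType) (H : falgType C) (n : nat)
    (x : n.+1.-tuple H) (N : 'I_n.+1 -> 'I_n.+1 -> 'I_n.+1 -> rat)
    (star : 'I_n.+1 -> 'I_n.+1)
    (mu : 'I_n.+1 -> {lrmorphism H -> C^o})
    (sharp : 'I_n.+1 -> 'I_n.+1) (i : 'I_n.+1) :
  abelian_rational_hypergroup x N star ->
  characters mu ->
  normalizable x mu ->
  dual_involution x star mu sharp ->
  h_integral_dual x mu sharp ->
  1 < ratr (hconst N star i) * `|chdim x mu i| ^+ 2 ->
  (forall j : 'I_n.+1,
     algebraic_integer (ratr (hconst N star i) * `|mu j (tnth x i)| ^+ 2)) ->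
  exists j : 'I_n.+1, mu j (tnth x i) = 0.
Proof.
move=> hg mu_chars d_neq0 sharpE z_int d_gt1 a_int.
have [/existsP[j /eqP zj]|] := boolP [exists j, mu j (tnth x i) == 0].
  by exists j.
rewrite negb_exists => /forallP nz; exfalso.
have [e mu_e] := exists_idempotents hg (char_inj mu_chars).
pose w : 'I_n.+1 -> C := weight x e.
have w_gt0 j : 0 < w j := weight_gt0 hg mu_e j.
have w0 j : w j != 0 by rewrite gt_eqF.
pose a j : C := ratr (hconst N star i) * `|mu j (tnth x i)| ^+ 2.
pose y : H := ratr (hconst N star i) *: (tnth x i * tnth x (star i)).
have mu_y j : mu j y = a j.
  by rewrite linearZ /= rmorphM /= (mu_star hg mu_e) /a normCK.
have w_nat j : exists m : nat, m%:R = w j / w ord0.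
  have [z] := z_int j.
  rewrite (dual_hconstE hg mu_e j d_neq0 sharpE) -/(w j) -/(w ord0) => zE.
  exists `|z|%N; rewrite zE natr_absz ger0_norm // -(ler0z C) -zE.
  by rewrite divr_ge0 // ltW.
have [m mE] := fin_all_exists w_nat.
(* Repetition turns the weights into multiplicities, so unweighted power sums and means apply. *)
pose s := flatten [seq nseq (m j) (a j) | j : 'I_n.+1].
have sumE (F : C -> C) : \sum_(b <- s) F b = (\sum_j w j * F (a j)) / w ord0.
  rewrite big_flatten /= big_map big_enum /= mulr_suml; apply: eq_bigr => j _.
  by rewrite big_nseq -Monoid.iteropE -/(_ *+ _) -mulr_natl mE mulrAC.
have tauE b : unit_coord x b = \sum_j w j * mu j b := unit_coordE hg mu_e b.
have sizeE : (size s)%:R = (w ord0)^-1.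
  have -> : (size s)%:R = \sum_(b <- s) 1 :> C.
    by rewrite big_const_seq count_predT iter_addr addr0.
  rewrite sumE (_ : \sum_j _ = 1) ?mul1r //.
  transitivity (unit_coord x (1 : H)); last first.
    by rewrite -(hg_unit hg) /unit_coord (coord_tnth hg) eqxx.
  by rewrite tauE; apply: eq_bigr => j _; rewrite rmorph1.
have powE k : \sum_(b <- s) b ^+ k = unit_coord x (y ^+ k) / w ord0.
  rewrite (sumE (fun b => b ^+ k)) tauE; congr (_ / _); apply: eq_bigr => j _.
  by rewrite rmorphXn /= mu_y.
have sP b : b \in s -> exists j, b = a j.
  by case/flatten_mapP => j _; rewrite mem_nseq => /andP[_ /eqP->]; exists j.
have h_gt0 : 0 < ratr (hconst N star i) :> C.
  by rewrite ltr0q invr_gt0 (hg_star_gt0 hg).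
have s_gt0 b : b \in s -> 0 < b.
  by move=> /sP[j ->]; rewrite mulr_gt0 // exprn_gt0 // normr_gt0.
have sA b : b \in s -> algebraic_integer b by move=> /sP[j ->]; exact: a_int.
have sQ k : is_rational (\sum_(b <- s) b ^+ k).
  rewrite powE -sizeE; apply: is_rationalM; last exact: is_rational_nat.
  exact: (unit_coord_rational_power hg).
have tau_y : unit_coord x y = 1.
  rewrite /unit_coord linearZ /= [X in _ * X](unit_coord_mul_star hg).
  rewrite (coord_tnth hg) eqxx mul1r fmorphV mulVf //.
  by rewrite fmorph_eq0 gt_eqF // (hg_star_gt0 hg).
have s_mean : \sum_(b <- s) b = (size s)%:R.
  by rewrite -(eq_bigr _ (fun b _ => expr1 b)) powE expr1 tau_y mul1r sizeE.
(* The multiplicity of [a ord0] is [w ord0 / w ord0], that is 1. *)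
have a0s : a ord0 \in s.
  apply/flatten_mapP; exists ord0; rewrite ?mem_enum // mem_nseq eqxx andbT.
  by rewrite -(ltr0n C) mE divff.
move: d_gt1; rewrite /chdim -/(a ord0).
by rewrite (mean1_integer_eq1 s_gt0 sA sQ s_mean a0s) ltxx.
Qed.

Theorem theorem4p17 (R : realType) (H : falgType (complex R)) (n : nat)
    (x : n.+1.-tuple H) (N : 'I_n.+1 -> 'I_n.+1 -> 'I_n.+1 -> rat)
    (star : 'I_n.+1 -> 'I_n.+1)
    (mu : 'I_n.+1 -> {lrmorphism H -> (complex R)^o})
    (sharp : 'I_n.+1 -> 'I_n.+1) (i : 'I_n.+1) :
  abelian_rational_hypergroup x N star ->
  characters mu ->
  normalizable x mu ->
  dual_involution x star mu sharp ->
  h_integral_dual x mu sharp ->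
  1 < ratr (hconst N star i) * `|chdim x mu i| ^+ 2 ->
  (forall j : 'I_n.+1,
     algebraic_integer (ratr (hconst N star i) * `|mu j (tnth x i)| ^+ 2)) ->
  exists j : 'I_n.+1, mu j (tnth x i) = 0.
Proof.
exact: vanishing_element.
Qed.
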